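(* Let $c>1$ satisfy $\zeta(c)=\sum_{i\ge1}i^{-c}>2$. Then $b(n)=\Omega(n^c)$; that is, there exists a constant $a>0$ such that $b(n)\ge a\,n^c$ for all positive integers $n$. Here $b(n)$ denotes the minimum number of leaves of a rooted tree that contains, as a topological minor, every binary rooted tree with $n$ leaves and no degree-1 nodes.
   Context: Trees are rooted and unordered, with edges directed from parent to child. The degree of a node is its number of children; a degree-1 node has exactly one child. A tree is binary if every node has at most two children. $T'$ is a topological minor of $T$ if there is an injective map $f$ from the nodes of $T'$ to the nodes of $T$ with $f(\mathsf{NCA}(u,v))=\mathsf{NCA}(f(u),f(v))$ for all $u,v$. Equivalently, $T$ contains a subdivision of $T'$ as a subgraph. $\mathsf{NCA}$ denotes the nearest common ancestor. *)

(* Defs.v *)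
From Stdlib Require Import Reals List Arith.
From Coquelicot Require Import Coquelicot.
Import ListNotations.

(* Rooted trees: a node with a list of children.  The order of the list is
   irrelevant for all notions below (nodes are addressed by paths, and
   topological minors are defined via injective NCA-preserving maps). *)
Inductive tree : Type := Node : list tree -> tree.

Fixpoint subtree (t : tree) (p : list nat) : option tree :=
  match p with
  | [] => Some t
  | i :: p' =>
      match t with
      | Node ts => match nth_error ts i with
                   | Some t' => subtree t' p'
                   | None => None
                   end
      end
  end.

Definition is_node (t : tree) (p : list nat) : Prop := subtree t p <> None.

Definition degree (t : tree) (p : list nat) : nat :=
  match subtree t p with
  | Some (Node ts) => length ts
  | None => 0%nat
  end.

Fixpoint nleaves (t : tree) : nat :=
  match t with
  | Node ts =>
      match ts with
      | [] => 1%nat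
      | _ => (fix go (l : list tree) : nat :=
                match l with [] => 0%nat | x :: r => (nleaves x + go r)%nat end) ts
      end
  end.

Definition full_binary (t : tree) : Prop :=
  forall p, is_node t p -> degree t p = 0%nat \/ degree t p = 2%nat.

(* nearest common ancestor of two nodes = longest common prefix of addresses *)
Fixpoint nca (p q : list nat) : list nat :=
  match p, q with
  | i :: p', j :: q' => if Nat.eqb i j then i :: nca p' q' else []
  | _, _ => []
  end.

Definition top_minor (T' T : tree) : Prop :=
  exists f : list nat -> list nat,
    (forall u, is_node T' u -> is_node T (f u)) /\
    (forall u v, is_node T' u -> is_node T' v -> f u = f v -> u = v) /\
    (forall u v, is_node T' u -> is_node T' v -> f (nca u v) = nca (f u) (f v)).

Definition universal (n : nat) (T : tree) : Prop :=
  forall B, full_binary B -> nleaves B = n -> top_minor B T.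

Definition zeta_term (c : R) (i : nat) : R := Rpower (INR (S i)) (- c).

(* Main.v *)
(** Let V_i be the set of nodes v of a universal tree T such that the subtree of
    v contains the caterpillar with i leaves.  If B has floor(n/i) leaves, then
    replacing each leaf of B by that caterpillar gives a tree with at most n
    leaves, and an embedding of it into T places B inside V_i.  Hence V_i is
    floor(n/i)-universal and has at least b(floor(n/i)) leaves.  A leaf of V_i is
    a non-unary node at which the largest contained caterpillar has exactly i
    leaves, so the leaves of the various V_i are distinct, and T has at most
    2 b(n) - 1 non-unary nodes.  Therefore
    [2 b(n) - 1 >= sum_(1 <= i <= n) b(floor(n/i))], which forces b(n) to grow
    like n^c as soon as [sum_(i >= 2) i^-c > 1]. *)
Require Import Defs.
From Stdlib Require Import Reals List Arith.
From Coquelicot Require Import Coquelicot.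
From Stdlib Require Import Lia Lra.
Import ListNotations.
Open Scope R_scope.

(** * Binary trees and inductive embeddings *)

Inductive btree : Type := Leaf | Branch (l r : btree).

Fixpoint size (b : btree) : nat :=
  match b with Leaf => 1 | Branch l r => size l + size r end.

Fixpoint tree_of (b : btree) : tree :=
  match b with
  | Leaf => Node []
  | Branch l r => Node [tree_of l; tree_of r]
  end.

(** Topological containment without node maps. The split of the child list in [embeds_branch] puts
    [t] and [t'] at distinct positions, even when they are equal as trees. *)
Inductive embeds : btree -> tree -> Prop :=
| embeds_leaf t : embeds Leaf t
| embeds_child b t ts : In t ts -> embeds b t -> embeds b (Node ts)
| embeds_branch l r t t' xs ys :
    In t' (xs ++ ys) -> embeds l t -> embeds r t' ->
    embeds (Branch l r) (Node (xs ++ t :: ys)).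

Definition embeds_all (n : nat) (t : tree) : Prop :=
  forall b, size b = n -> embeds b t.

Lemma size_pos b : (1 <= size b)%nat.
Proof. induction b; simpl; lia. Qed.

(** * From topological minors to embeddings *)

Lemma tree_of_full_binary b : full_binary (tree_of b).
Proof.
  induction b as [|l IHl r IHr]; intros p Hp; destruct p as [|i p].
  - left; reflexivity.
  - exfalso; apply Hp; destruct i; reflexivity.
  - right; reflexivity.
  - destruct i as [|[|i]].
    + exact (IHl p Hp).
    + exact (IHr p Hp).
    + exfalso; apply Hp; destruct i; reflexivity.
Qed.

Lemma nleaves_Node ts :
  ts <> [] -> nleaves (Node ts) = list_sum (map nleaves ts).
Proof.
  destruct ts as [|t ts]; [easy|]; intros _.
  simpl; f_equal.
  induction ts as [|u ts IH]; simpl; congruence.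
Qed.

Lemma tree_of_nleaves b : nleaves (tree_of b) = size b.
Proof. induction b as [|l IHl r IHr]; simpl in *; lia. Qed.

Lemma subtree_app t p q :
  subtree t (p ++ q) =
  match subtree t p with Some t' => subtree t' q | None => None end.
Proof.
  revert t; induction p as [|i p IH]; intros [ts]; simpl; [reflexivity|].
  destruct (nth_error ts i); [apply IH | reflexivity].
Qed.

Lemma embeds_subtree b t p t' :
  subtree t p = Some t' -> embeds b t' -> embeds b t.
Proof.
  revert t; induction p as [|i p IH]; intros [ts] H Hb; simpl in H.
  - congruence.
  - destruct (nth_error ts i) as [u|] eqn:E; [|easy].
    apply embeds_child with u; [eapply nth_error_In; eauto | eauto].
Qed.

Lemma nca_prefix p q : nca p q = p -> exists s, q = p ++ s.
Proof.
  revert q; induction p as [|i p IH]; intros q H; [now exists q|].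
  destruct q as [|j q]; simpl in H; [easy|].
  destruct (Nat.eqb_spec i j) as [<-|]; [|easy].
  injection H as H; destruct (IH q H) as [s ->]; now exists s.
Qed.

Lemma nca_app p s t : nca (p ++ s) (p ++ t) = p ++ nca s t.
Proof.
  induction p as [|i p IH]; simpl; [reflexivity|].
  now rewrite Nat.eqb_refl, IH.
Qed.

Lemma embeds_branch_nth l r ts i j t t' :
  i <> j -> nth_error ts i = Some t -> nth_error ts j = Some t' ->
  embeds l t -> embeds r t' -> embeds (Branch l r) (Node ts).
Proof.
  intros Hij Hi Hj Hl Hr.
  destruct (nth_error_split ts i Hi) as (xs & ys & -> & Hlen).
  apply embeds_branch with t'; trivial.
  apply in_or_app.
  destruct (Nat.lt_ge_cases j i) as [Hji|Hji].
  - left; rewrite nth_error_app1 in Hj by lia; eapply nth_error_In; eauto.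
  - right; rewrite nth_error_app2 in Hj by lia.
    destruct (j - length xs)%nat as [|k] eqn:E; [lia|].
    eapply nth_error_In; eauto.
Qed.

(** Induction on [b]: below either child, [f] is again injective and preserves common ancestors. The
    address [f []] is a prefix of both child images. Injectivity makes the two remainders nonempty,
    and as they have no common prefix, they start in different children. *)
Lemma embeds_of_map b t (f : list nat -> list nat) :
  (forall u, is_node (tree_of b) u -> is_node t (f u)) ->
  (forall u v, is_node (tree_of b) u -> is_node (tree_of b) v ->
     f u = f v -> u = v) ->
  (forall u v, is_node (tree_of b) u -> is_node (tree_of b) v ->
     f (nca u v) = nca (f u) (f v)) ->
  forall t', subtree t (f []) = Some t' -> embeds b t'.
Proof.
  revert f; induction b as [|l IHl r IHr]; intros f Hnode Hinj Hnca t' Ht';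
    [constructor|].
  assert (N : is_node (tree_of (Branch l r)) []) by easy.
  assert (NL : forall u, is_node (tree_of l) u ->
            is_node (tree_of (Branch l r)) (0%nat :: u)) by (intros u Hu; exact Hu).
  assert (NR : forall u, is_node (tree_of r) u ->
            is_node (tree_of (Branch l r)) (1%nat :: u)) by (intros u Hu; exact Hu).
  assert (N0 : is_node (tree_of (Branch l r)) [0%nat])
    by (apply NL; now destruct l).
  assert (N1 : is_node (tree_of (Branch l r)) [1%nat])
    by (apply NR; now destruct r).
  assert (El : forall s, subtree t (f [0%nat]) = Some s -> embeds l s).
  { apply (IHl (fun u => f (0%nat :: u))); auto.
    - intros u v Hu Hv E; apply Hinj in E; auto; congruence.
    - intros u v Hu Hv; rewrite <- Hnca by auto; reflexivity. }
  assert (Er : forall s, subtree t (f [1%nat]) = Some s -> embeds r s).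
  { apply (IHr (fun u => f (1%nat :: u))); auto.
    - intros u v Hu Hv E; apply Hinj in E; auto; congruence.
    - intros u v Hu Hv; rewrite <- Hnca by auto; reflexivity. }
  destruct (nca_prefix (f []) (f [0%nat])) as [s0 E0];
    [now rewrite <- Hnca|].
  destruct (nca_prefix (f []) (f [1%nat])) as [s1 E1];
    [now rewrite <- Hnca|].
  assert (E01 : nca s0 s1 = []).
  { apply (app_inv_head (f [])).
    rewrite <- nca_app, <- E0, <- E1, <- Hnca, app_nil_r by trivial; reflexivity. }
  pose proof (Hnode _ N0) as H0; pose proof (Hnode _ N1) as H1.
  unfold is_node in H0, H1.
  destruct (subtree t (f [0%nat])) as [t0|] eqn:S0; [clear H0|easy].
  destruct (subtree t (f [1%nat])) as [t1|] eqn:S1; [clear H1|easy].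
  rewrite E0, subtree_app, Ht' in S0; rewrite E1, subtree_app, Ht' in S1.
  destruct s0 as [|i s0].
  { exfalso; rewrite app_nil_r in E0; apply Hinj in E0; easy. }
  destruct s1 as [|j s1].
  { exfalso; rewrite app_nil_r in E1; apply Hinj in E1; easy. }
  destruct t' as [ts]; simpl in S0, S1, E01.
  destruct (nth_error ts i) as [u0|] eqn:T0; [|easy].
  destruct (nth_error ts j) as [u1|] eqn:T1; [|easy].
  apply embeds_branch_nth with i j u0 u1; trivial.
  - intros ->; now rewrite Nat.eqb_refl in E01.
  - eapply embeds_subtree; eauto.
  - eapply embeds_subtree; eauto.
Qed.

Lemma universal_embeds_all n t : universal n t -> embeds_all n t.
Proof.
  intros U b Hb.
  destruct (U (tree_of b) (tree_of_full_binary b)) as (f & Hnode & Hinj & Hnca);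
    [now rewrite tree_of_nleaves|].
  assert (H : is_node t (f [])) by (apply Hnode; now destruct b).
  unfold is_node in H; destruct (subtree t (f [])) as [t'|] eqn:E; [|easy].
  eapply embeds_subtree; eauto using embeds_of_map.
Qed.

(** * Monotonicity in the number of leaves *)

Lemma embeds_branch_r l b t : embeds (Branch l b) t -> embeds b t.
Proof.
  remember (Branch l b) as B eqn:E; intros H; revert E.
  induction H as [t|B t ts Hin H IH|l' r t t' xs ys Hin Hl _ Hr _]; intros E.
  - easy.
  - eauto using embeds_child.
  - injection E as -> ->.
    apply embeds_child with t'; trivial.
    rewrite in_app_iff in *; simpl; tauto.
Qed.

(** Since [Branch Leaf b] contains [b] and has one leaf more, the size can be lowered one by one. *)
Lemma embeds_all_le m n t :
  (1 <= m <= n)%nat -> embeds_all n t -> embeds_all m t.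
Proof.
  intros [Hm Hmn]; induction Hmn as [|n Hmn IH]; [trivial|].
  intros H; apply IH; intros b Hb.
  apply embeds_branch_r with Leaf, H; simpl; lia.
Qed.

(** * Height and rank *)

Fixpoint height (b : btree) : nat :=
  match b with Leaf => 1 | Branch l r => S (Nat.max (height l) (height r)) end.

(* The number of leaves of the largest caterpillar embedded in [t]: one more
   than the largest number of branching nodes on a downward path, unary nodes
   being transparent. *)
Fixpoint rank (t : tree) : nat :=
  match t with
  | Node ts =>
      match ts with
      | [] => 1
      | [t'] => rank t'
      | _ => S (list_max (map rank ts))
      end
  end.

Lemma rank_Node ts :
  (2 <= length ts)%nat -> rank (Node ts) = S (list_max (map rank ts)).
Proof. destruct ts as [|t [|u ts]]; simpl length; [lia|lia|reflexivity]. Qed.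

Lemma le_list_max x xs : In x xs -> (x <= list_max xs)%nat.
Proof.
  assert (H := proj1 (list_max_le xs (list_max xs)) (le_n _)).
  rewrite Forall_forall in H; auto.
Qed.

Lemma rank_child t ts : In t ts -> (rank t <= rank (Node ts))%nat.
Proof.
  intros Hin; destruct (le_lt_dec 2 (length ts)) as [H|H].
  - rewrite rank_Node by trivial.
    apply Nat.le_trans with (list_max (map rank ts)); [|lia].
    now apply le_list_max, in_map.
  - destruct ts as [|u [|v ts]]; simpl in *; [easy| |lia].
    destruct Hin as [->|[]]; lia.
Qed.


Lemma tree_ind' (P : tree -> Prop) :
  (forall ts, List.Forall P ts -> P (Node ts)) -> forall t, P t.
Proof.
  intros H; fix IH 1; intros [ts]; apply H.
  induction ts as [|t ts IHts]; constructor; [apply IH|apply IHts].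
Qed.

Lemma rank_pos t : (1 <= rank t)%nat.
Proof.
  induction t as [ts IH] using tree_ind'.
  destruct IH as [|t [|u ts] IHt _]; simpl in *; lia.
Qed.

(** A branching of [b] sits at a node with at least two children, where the rank exceeds that of
    every child; elsewhere the rank does not drop on the way up. *)
Lemma height_le_rank b t : embeds b t -> (height b <= rank t)%nat.
Proof.
  induction 1 as [t|b t ts Hin H IH|l r t t' xs ys Hin Hl IHl Hr IHr].
  - apply rank_pos.
  - apply Nat.le_trans with (rank t); [trivial | now apply rank_child].
  - assert (Hin' : In t' (xs ++ t :: ys))
      by (rewrite in_app_iff in *; simpl; tauto).
    rewrite rank_Node.
    + simpl; apply le_n_S, Nat.max_lub.
      * apply Nat.le_trans with (rank t); [trivial|].
        apply le_list_max, in_map, in_elt.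
      * apply Nat.le_trans with (rank t'); [trivial|].
        now apply le_list_max, in_map.
    + enough (length (xs ++ ys) <> 0)%nat
        by (rewrite length_app in *; simpl; lia).
      now destruct (xs ++ ys).
Qed.

(** * Pruning and grafting *)

(** For [t] of rank at least [i], this is the set V_i. The root is kept whatever its rank. *)
Fixpoint prune (i : nat) (t : tree) : tree :=
  match t with
  | Node ts =>
      Node (flat_map (fun s => if (i <=? rank s)%nat then [prune i s] else []) ts)
  end.

Fixpoint graft (b x : btree) : btree :=
  match b with
  | Leaf => x
  | Branch l r => Branch (graft l x) (graft r x)
  end.

Fixpoint caterpillar (n : nat) : btree :=
  match n with 0 => Leaf | S n => Branch Leaf (caterpillar n) end.

Lemma size_graft b x : size (graft b x) = (size b * size x)%nat.
Proof. induction b as [|l IHl r IHr]; simpl; lia. Qed.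

Lemma size_caterpillar n : size (caterpillar n) = S n.
Proof. induction n; simpl; lia. Qed.

Lemma height_caterpillar n : height (caterpillar n) = S n.
Proof. induction n as [|n IH]; simpl; [|rewrite IH]; lia. Qed.

Lemma height_graft b x : (height x <= height (graft b x))%nat.
Proof. induction b; simpl; lia. Qed.

(** Every node of [t] that serves [b] has a copy of [x] in its subtree, so its rank is at least
    [height x] and it survives the pruning. *)
Lemma embeds_prune b x t :
  embeds (graft b x) t -> embeds b (prune (height x) t).
Proof.
  assert (R : forall b s, embeds (graft b x) s ->
            (if (height x <=? rank s)%nat then [prune (height x) s] else [])
            = [prune (height x) s]).
  { intros b' s H; apply height_le_rank in H.
    pose proof (height_graft b' x).
    destruct (Nat.leb_spec (height x) (rank s)); [reflexivity|lia]. }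
  remember (graft b x) as B eqn:E; intros H; revert b E.
  induction H as [t|B t ts Hin H IH|l r t t' xs ys Hin Hl IHl Hr IHr];
    intros b E.
  - destruct b; [constructor|easy].
  - subst B; simpl; apply embeds_child with (prune (height x) t); [|auto].
    apply in_flat_map; exists t; split; trivial.
    rewrite (R _ _ H); now left.
  (* If [b] is a leaf, this branching belongs to [x], and a leaf embeds anywhere. *)
  - destruct b as [|b1 b2]; [constructor|].
    injection E as -> ->; simpl.
    rewrite flat_map_app; simpl; rewrite (R _ _ Hl); simpl.
    apply embeds_branch with (prune (height x) t'); auto.
    rewrite <- flat_map_app.
    apply in_flat_map; exists t'; split; trivial.
    rewrite (R _ _ Hr); now left.
Qed.

Lemma embeds_all_prune n i t :
  (1 <= i <= n)%nat -> embeds_all n t ->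
  embeds_all (n / i) (prune i t) /\ (i <= rank t)%nat.
Proof.
  intros Hi U; destruct i as [|j]; [lia|].
  assert (Hc : forall b, (size b * S j <= n)%nat ->
            embeds (graft b (caterpillar j)) t).
  { intros b Hb; apply (embeds_all_le (size b * S j) n); trivial.
    - split; [|trivial]; pose proof (size_pos b); nia.
    - now rewrite size_graft, size_caterpillar. }
  split.
  - intros b Hb; rewrite <- (height_caterpillar j).
    apply embeds_prune, Hc; rewrite Hb.
    rewrite Nat.mul_comm; apply Nat.Div0.mul_div_le.
  (* Grafting onto a single leaf gives the caterpillar itself. *)
  - rewrite <- (height_caterpillar j); apply height_le_rank.
    apply (Hc Leaf); simpl; lia.
Qed.

(** * Counting the leaves of all prunings *)

(** The value 0 stands for an empty V_i, where [prune i t] would still keep the root. *)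
Definition pruned_leaves (i : nat) (t : tree) : nat :=
  if (i <=? rank t)%nat then nleaves (prune i t) else 0.

Lemma list_sum_flat_map i ts :
  list_sum (map nleaves
    (flat_map (fun s => if (i <=? rank s)%nat then [prune i s] else []) ts))
  = list_sum (map (pruned_leaves i) ts).
Proof.
  induction ts as [|t ts IH]; simpl; [reflexivity|].
  rewrite map_app, list_sum_app, IH; f_equal.
  unfold pruned_leaves; destruct (i <=? rank t)%nat; simpl; lia.
Qed.

(* The first summand accounts for the root becoming a leaf of [prune i t]. *)
Lemma pruned_leaves_Node i ts :
  ts <> [] ->
  (pruned_leaves i (Node ts) <=
   (if (2 <=? length ts)%nat then if (i =? rank (Node ts))%nat then 1 else 0 else 0)
   + list_sum (map (pruned_leaves i) ts))%nat.
Proof.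
  intros Hts; unfold pruned_leaves at 1.
  destruct (Nat.leb_spec i (rank (Node ts))) as [Hi|Hi]; [|lia].
  cbn [prune].
  destruct (flat_map _ ts) as [|u us] eqn:E.
  - assert (Hlt : forall t, In t ts -> (rank t < i)%nat).
    { intros t Ht; destruct (Nat.leb_spec i (rank t)) as [H|H]; [|trivial].
      exfalso; apply (in_nil (a := prune i t)); rewrite <- E.
      apply in_flat_map; exists t; split; trivial.
      apply Nat.leb_le in H; rewrite H; now left. }
    (* All children have rank below [i], the node does not. With two or more children its rank is
       therefore exactly [i]; a single child would have the same rank as the node. *)
    destruct (Nat.leb_spec 2 (length ts)) as [H2|H2].
    + rewrite rank_Node in * by trivial.
      assert (H : (list_max (map rank ts) < i)%nat).
      { apply list_max_lt; [now destruct ts|].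
        apply Forall_map, Forall_forall; exact Hlt. }
      replace i with (S (list_max (map rank ts))) at 1 by lia.
      rewrite Nat.eqb_refl; simpl; lia.
    + destruct ts as [|t [|t' ts]]; simpl in *; [easy| |lia].
      specialize (Hlt t (or_introl eq_refl)); lia.
  - rewrite nleaves_Node by easy.
    rewrite <- E, list_sum_flat_map; lia.
Qed.

Lemma list_sum_map_add {A : Type} (f g : A -> nat) xs :
  list_sum (map (fun x => f x + g x)%nat xs)
  = (list_sum (map f xs) + list_sum (map g xs))%nat.
Proof. induction xs; simpl; lia. Qed.

Lemma list_sum_map_le {A : Type} (f g : A -> nat) xs :
  (forall x, In x xs -> (f x <= g x)%nat) ->
  (list_sum (map f xs) <= list_sum (map g xs))%nat.
Proof.
  induction xs as [|x xs IH]; simpl; intros H; [lia|].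
  apply Nat.add_le_mono; auto.
Qed.

Lemma list_sum_indicator k xs :
  NoDup xs -> (list_sum (map (fun i => if (i =? k)%nat then 1 else 0) xs) <= 1)%nat.
Proof.
  intros H; induction H as [|x xs Hx H IH]; simpl; [lia|].
  destruct (Nat.eqb_spec x k) as [->|_]; [|exact IH].
  enough (list_sum (map (fun i => if (i =? k)%nat then 1 else 0) xs) <= 0)%nat by lia.
  clear IH H; induction xs as [|y xs IH]; simpl in *; [lia|].
  destruct (Nat.eqb_spec y k); [tauto|]; apply IH; tauto.
Qed.

Lemma sum_pruned_leaves N t :
  (list_sum (map (fun i => pruned_leaves i t) (seq 1 N)) + 1 <= 2 * nleaves t)%nat.
Proof.
  induction t as [ts IH] using tree_ind'.
  assert (Hseq := seq_NoDup N 1).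
  destruct ts as [|t0 ts0] eqn:Ets; [|rewrite <- Ets in *].
  - replace (2 * nleaves (Node []))%nat with 2%nat by reflexivity.
    pose proof (list_sum_indicator 1 _ Hseq) as H1.
    assert (H : (list_sum (map (fun i => pruned_leaves i (Node [])) (seq 1 N)) <=
      list_sum (map (fun i => if (i =? 1)%nat then 1 else 0) (seq 1 N)))%nat).
    { apply list_sum_map_le; intros i Hi; apply in_seq in Hi.
      unfold pruned_leaves; simpl.
      destruct i as [|[|i]]; simpl; lia. }
    lia.
  - assert (Hts : ts <> []) by (subst; easy).
    rewrite nleaves_Node by trivial; clear Ets t0 ts0.
    (* The [+ 1] of each child adds up to [length ts]. This pays for the [+ 1] of the goal and, when
       there are at least two children, for the one [i] at which the root becomes a leaf. *)
    assert (H1 : (list_sum (map (fun i => list_sum (map (pruned_leaves i) ts)) (seq 1 N))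
              + length ts <= 2 * list_sum (map nleaves ts))%nat).
    { clear Hts; induction IH as [|t ts Ht IHF IHts]; simpl.
      - enough (list_sum (map (fun _ => 0%nat) (seq 1 N)) = 0%nat) by lia.
        clear; induction (seq 1 N); simpl; lia.
      - rewrite list_sum_map_add; lia. }
    pose proof (list_sum_map_le _ _ (seq 1 N)
      (fun i _ => pruned_leaves_Node i ts Hts)) as H2.
    rewrite list_sum_map_add in H2.
    destruct (Nat.leb_spec 2 (length ts)) as [L|L].
    + pose proof (list_sum_indicator (rank (Node ts)) _ Hseq); lia.
    + assert (length ts <> 0)%nat by (now destruct ts).
      assert (list_sum (map (fun _ => 0%nat) (seq 1 N)) = 0%nat)
        by (clear; induction (seq 1 N); simpl; lia).
      lia.
Qed.

Lemma nleaves_pos t : (1 <= nleaves t)%nat.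
Proof. pose proof (sum_pruned_leaves 0 t); lia. Qed.

Lemma prune_1 t : prune 1 t = t.
Proof.
  induction t as [ts IH] using tree_ind'; simpl; f_equal.
  induction IH as [|t ts Ht _ IH]; simpl; [reflexivity|].
  destruct (rank t) eqn:E; [pose proof (rank_pos t); lia|].
  simpl; congruence.
Qed.

(** * The recursive lower bound over the reals *)

Lemma sum_n_INR (f : nat -> nat) N :
  sum_n (fun j => INR (f (S j))) N = INR (list_sum (map f (seq 1 (S N)))).
Proof.
  induction N as [|N IH].
  - rewrite sum_O; simpl; f_equal; lia.
  - rewrite sum_Sn, IH, (seq_S (S N)), map_app, list_sum_app, plus_INR.
    unfold plus; simpl; f_equal; f_equal; lia.
Qed.

(** The term at 0 stays unscaled: it will be the leaf count of the whole tree, the quantity to be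
    bounded. *)
Lemma sum_n_scaled_le (C : R) (x y : nat -> R) N :
  (forall j, (1 <= j <= N)%nat -> C * y j <= x j) ->
  x 0%nat + C * (sum_n y N - y 0%nat) <= sum_n x N.
Proof.
  induction N as [|N IH]; intros H.
  - rewrite !sum_O; lra.
  - rewrite !sum_Sn; unfold plus; simpl.
    assert (H1 := H (S N)); assert (H2 : forall j, (1 <= j <= N)%nat -> C * y j <= x j)
      by (intros; apply H; lia).
    specialize (H1 ltac:(lia)); specialize (IH H2); lra.
Qed.

(** In the counting inequality the term for i = 1 is [nleaves t], which cancels one of the two
    copies on the right. Each term with 2 <= i <= N + 1 is bounded by induction at n / i. *)
Lemma nleaves_recursion (c a theta : R) (N n : nat) (t : tree) :
  0 < c -> 0 <= a -> 0 < theta <= 1 ->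
  INR (S N) <= INR n * (1 - theta) ->
  (forall m, (1 <= m < n)%nat -> forall u, embeds_all m u ->
     a * Rpower (INR m) c <= INR (nleaves u)) ->
  embeds_all n t ->
  a * Rpower theta c * Rpower (INR n) c * (sum_n (zeta_term c) N - 1)
  <= INR (nleaves t).
Proof.
  intros Hc Ha Htheta Hn IH Ht.
  assert (HSN : 1 <= INR (S N)) by (apply (le_INR 1); lia).
  assert (Hn0 : 0 <= INR n) by apply pos_INR.
  assert (Hn1 : INR (S N) <= INR n) by nra.
  assert (HnN : (S N <= n)%nat) by now apply INR_le.
  assert (Hnpos : 0 < INR n) by lra.
  assert (Hsum := le_INR _ _ (sum_pruned_leaves (S N) t)).
  rewrite plus_INR, mult_INR, <- sum_n_INR in Hsum.
  simpl INR in Hsum.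
  assert (H0 : pruned_leaves 1 t = nleaves t).
  { unfold pruned_leaves; rewrite prune_1.
    destruct (Nat.leb_spec 1 (rank t)); [trivial|].
    pose proof (rank_pos t); lia. }
  assert (Hz0 : zeta_term c 0 = 1).
  { unfold zeta_term; simpl; unfold Rpower; rewrite ln_1, Rmult_0_r; apply exp_0. }
  assert (H := sum_n_scaled_le (a * Rpower theta c * Rpower (INR n) c)
    (fun j => INR (pruned_leaves (S j) t)) (zeta_term c) N).
  cbv beta in H; rewrite H0, Hz0 in H.
  enough (Hj : forall j, (1 <= j <= N)%nat ->
    a * Rpower theta c * Rpower (INR n) c * zeta_term c j
    <= INR (pruned_leaves (S j) t)) by (specialize (H Hj); lra).
  clear H Hsum; intros j Hj.
  destruct (embeds_all_prune n (S j) t) as [Hp Hr]; [lia|trivial|].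
  unfold pruned_leaves; rewrite (proj2 (Nat.leb_le _ _) Hr).
  assert (Hdiv := Nat.div_mod_eq n (S j)).
  assert (Hmod := Nat.mod_upper_bound n (S j) ltac:(lia)).
  assert (Hq : (1 <= n / S j < n)%nat)
    by (split; [apply Nat.div_str_pos | apply Nat.div_lt]; lia).
  eapply Rle_trans; [|now apply IH].
  assert (Hi : 1 <= INR (S j)) by (apply (le_INR 1); lia).
  unfold zeta_term; rewrite !Rmult_assoc.
  apply Rmult_le_compat_l; [trivial|].
  replace (Rpower (INR (S j)) (- c)) with (Rpower (/ INR (S j)) c)
    by (unfold Rpower; rewrite ln_Rinv by lra; f_equal; ring).
  assert (0 < / INR (S j)) by (apply Rinv_0_lt_compat; lra).
  rewrite !Rpower_mult_distr; try nra.
  apply Rle_Rpower_l; [lra|]; split; [apply Rmult_lt_0_compat; nra|].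
  (* Rounding loses at most 1, and i <= N + 1 <= n (1 - theta) gives n / i - 1 >= theta n / i. *)
  assert (Hfloor : INR n <= INR (S j) * INR (n / S j) + INR (S j)).
  { rewrite <- mult_INR, <- plus_INR; apply le_INR; lia. }
  assert (INR (S j) <= INR (S N)) by (apply le_INR; lia).
  apply Rmult_le_reg_l with (INR (S j)); [lra|].
  replace (INR (S j) * (theta * (INR n * / INR (S j)))) with (theta * INR n)
    by (field; lra).
  lra.
Qed.

(** * Choice of constants and strong induction *)

Theorem theorem5 (c : R) (hc : 1 < c)
  (hzeta : exists z : R, is_series (zeta_term c) z /\ 2 < z) :
  exists a : R, 0 < a /\
    forall (n : nat), (1 <= n)%nat ->
    forall T : tree, universal n T ->
      a * Rpower (INR n) c <= INR (nleaves T).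
Proof.
  destruct hzeta as (z & Hz & Hz2).
  (* Some partial sum already exceeds 2, so finitely many i suffice. *)
  destruct (Hz (fun y => 2 < y) (open_gt 2 z Hz2)) as [N HN].
  specialize (HN N (le_n N)); change (2 < sum_n (zeta_term c) N) in HN.
  set (s := sum_n (zeta_term c) N - 1).
  assert (Hs : 1 < s) by (unfold s; lra).
  (* [theta] absorbs the rounding in [n / i], and is chosen so that
     [theta ^ c * sum_(2 <= i <= N + 1) i ^ -c = 1]. *)
  set (theta := Rpower s (- / c)).
  assert (Hc : 0 < / c) by (apply Rinv_0_lt_compat; lra).
  assert (Htheta0 : 0 < theta) by apply exp_pos.
  assert (Htheta1 : theta < 1).
  { unfold theta; rewrite <- (Rpower_O s) by lra; apply Rpower_lt; lra. }
  assert (Hthetac : Rpower theta c * s = 1).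
  { unfold theta; rewrite Rpower_mult.
    replace (- / c * c) with (- (1)) by (field; lra).
    rewrite Rpower_Ropp, Rpower_1 by lra; field; lra. }
  (* Beyond [n0] the slack [theta] covers the rounding. *)
  destruct (INR_unbounded (INR (S N) / (1 - theta))) as [n0 Hn0].
  assert (Hn0' : INR (S N) < INR n0 * (1 - theta)).
  { apply (Rmult_lt_compat_r (1 - theta)) in Hn0; [|lra].
    replace (INR (S N) / (1 - theta) * (1 - theta)) with (INR (S N)) in Hn0
      by (field; lra); trivial. }
  (* With this [a] the bound is at most 1 for all n <= [n0], where a single leaf is enough. *)
  set (a := / Rpower (INR n0) c).
  assert (Hpow : 0 < Rpower (INR n0) c) by apply exp_pos.
  assert (Ha : 0 < a) by now apply Rinv_0_lt_compat.
  exists a; split; trivial.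
  (* The induction runs over [embeds_all], the property that prunings inherit. *)
  intros n Hn T HT; apply universal_embeds_all in HT; revert Hn T HT.
  induction n as [n IH] using lt_wf_ind; intros Hn T HT.
  assert (HnR : 1 <= INR n) by (apply (le_INR 1); lia).
  destruct (Nat.le_gt_cases n n0) as [Hle|Hgt].
  - apply Rle_trans with 1; [|apply (le_INR 1), nleaves_pos].
    replace 1 with (a * Rpower (INR n0) c) by (unfold a; field; lra).
    apply Rmult_le_compat_l; [lra|].
    apply Rle_Rpower_l; [lra|]; split; [lra|now apply le_INR].
  - assert (INR n0 <= INR n) by (apply le_INR; lia).
    replace (a * Rpower (INR n) c)
      with (a * Rpower theta c * Rpower (INR n) c * s)
      by (transitivity (a * Rpower (INR n) c * (Rpower theta c * s));
          [ring | rewrite Hthetac; ring]).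
    apply nleaves_recursion; trivial; try lra.
    + nra.
    + intros m Hm u Hu; apply IH; trivial; lia.
Qed.
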